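(* Let $X$ be a real reflexive Banach space with dual $Y$, let $\phi \in \Gamma_0(X)$ and let $\varepsilon > 0$. Let $$M(\phi,\varepsilon) = \{ (x,y) \in X \times Y : \text{there is } a \in Y \text{ with } \|a\| \leq \varepsilon \text{ and } y + a \in \partial \phi(x) \}.$$ Suppose that for every $y \in Y$ the set $$\bigcup_{\bar{y} \in Y,\ \|\bar{y} - y\| \leq \varepsilon} \partial \phi^{*}(\bar{y})$$ is convex. Then there exists a bipotential $b : X \times Y \to \mathbb{R} \cup \{+\infty\}$ such that $M(\phi,\varepsilon) = M(b)$. Therefore, there is a function $b: X \times Y \to \mathbb{R}\cup\{+\infty\}$, lower semicontinuous and convex in each variable, such that for $(x,y) \in X \times Y$ each of the following relations is equivalent to $(x,y) \in M(\phi,\varepsilon)$: (a) $y \in \partial b(\cdot,y)(x)$; (b) $x \in \partial b(x,\cdot)(y)$; (c) $b(x,y) = \langle x,y\rangle$.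
   Context: $X$ is a real reflexive Banach space, $Y = X^*$ its dual, $\langle x,y\rangle = y(x)$, and $\|\cdot\|$ denotes both the norm of $X$ and the dual norm of $Y$. By reflexivity, the dual of $Y$ is identified with $X$. Conventions: $\bar{\mathbb{R}} = \mathbb{R}\cup\{+\infty\}$; $a + (+\infty) = +\infty$ for $a\in\bar{\mathbb{R}}$, and $a\cdot(+\infty) = +\infty$ for all $a \geq 0$. For $\psi: X \to \bar{\mathbb{R}}$, $\mathrm{dom}\,\psi = \{x : \psi(x) \in \mathbb{R}\}$. $\Gamma_0(X)$ is the set of convex lower semicontinuous functions $\psi : X \to \bar{\mathbb{R}}$ with $\mathrm{dom}\,\psi \neq \emptyset$; $\Gamma_0(Y)$ is defined similarly. The subdifferential is $\partial\psi(x) = \{u \in Y : \langle z - x, u\rangle \leq \psi(z) - \psi(x)\ \forall z \in X\}$, understood to be empty if $\psi(x) = +\infty$; for functions on $Y$ the subdifferential is a subset of $X$, defined analogously. The Fenchel conjugate of $\phi$ is $\phi^*(y) = \sup_{x\in X}(\langle x,y\rangle - \phi(x))$. A bipotential is a function $b : X\times Y \to \bar{\mathbb{R}}$ such that: (a) for any $x\in X$, if $\mathrm{dom}\, b(x,\cdot) \neq \emptyset$ then $b(x,\cdot)\in\Gamma_0(Y)$; for any $y \in Y$, if $\mathrm{dom}\, b(\cdot,y)\neq\emptyset$ then $b(\cdot,y)\in\Gamma_0(X)$; (b) $b(x,y)\geq\langle x,y\rangle$ for all $(x,y) \in X\times Y$; (c) for all $(x,y)\in X\times Y$: $y\in\partial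 b(\cdot,y)(x) \iff x\in\partial b(x,\cdot)(y) \iff b(x,y)=\langle x,y\rangle$. The graph of $b$ is $M(b) = \{(x,y)\in X\times Y : b(x,y)=\langle x,y\rangle\}$. *)

(* Defs.v *)
From HB Require Import structures.
From mathcomp Require Import all_boot all_order all_algebra.
From mathcomp Require Import all_classical all_reals all_analysis.

Set Implicit Arguments.
Unset Strict Implicit.
Unset Printing Implicit Defensive.

Import Order.TTheory GRing.Theory Num.Theory.
Import numFieldNormedType.Exports.

Local Open Scope classical_set_scope.
Local Open Scope ring_scope.

Section cdual.
Context {R : realType} {X : normedModType R}.

Definition cdual_pred : {pred X -> R^o} :=
  [pred f | `[< linear f /\ continuous f >]].

Record cdual := CDual {
  cdual_fun :> X -> R^o;
  cdual_funP : cdual_fun \in cdual_pred }.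

HB.instance Definition _ := [isSub for cdual_fun].
HB.instance Definition _ := [Choice of cdual by <:].

Fact cdual_submod_closed : submod_closed cdual_pred.
Proof.
split; first by rewrite inE; split=> [a u v|x]; rewrite ?scaler0 ?addr0//;
  exact: cst_continuous.
move=> a f g; rewrite !inE => -[lf cf] [lg cg]; split=> [k u v|x].
  rewrite !fctE (lf k u v) (lg k u v) !scalerDr !scalerA addrACA.
  by rewrite (mulrC k a).
by apply: cvgD; [apply: cvgZr; exact: cf|exact: cg].
Qed.
HB.instance Definition _ :=
  GRing.isSubmodClosed.Build R (X -> R^o) cdual_pred cdual_submod_closed.
HB.instance Definition _ := [SubChoice_isSubLmodule of cdual by <:].

Lemma cdual_linear (f : cdual) : linear f.
Proof. by have := cdual_funP f; rewrite inE => -[]. Qed.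
HB.instance Definition _ (f : cdual) :=
  GRing.isLinear.Build R X R^o *:%R (cdual_fun f) (cdual_linear f).

Lemma cdual_continuous (f : cdual) : continuous f.
Proof. by have := cdual_funP f; rewrite inE => -[]. Qed.

Lemma cdualP (f g : cdual) : (forall x, f x = g x) -> f = g.
Proof. by move=> fg; apply/val_inj/funext. Qed.

Lemma cdualD (f g : cdual) x : (f + g) x = f x + g x.
Proof. by []. Qed.

Lemma cdualZ (a : R) (f : cdual) x : (a *: f) x = a * f x.
Proof. by []. Qed.

Definition opnorm (f : cdual) : R :=
  sup [set `|f x| | x in [set x : X | `|x| <= 1]].

Lemma opnorm_has_sup (f : cdual) :
  has_sup [set `|f x| | x in [set x : X | `|x| <= 1]].
Proof.
split; first by exists `|f 0|, 0 => //=; rewrite normr0.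
have /linear_boundedP/pinfty_ex_gt0[M M0 fM] :=
  continuous_linear_bounded 0 (@cdual_continuous f 0).
exists M => _ [x /= x1 <-]; apply: (le_trans (fM x)).
by rewrite ler_piMr// ltW.
Qed.

Lemma opnorm_ub (f : cdual) x : `|x| <= 1 -> `|f x| <= opnorm f.
Proof.
by move=> x1; apply: sup_upper_bound; [exact: opnorm_has_sup|exists x].
Qed.

Lemma opnorm_le (f : cdual) M :
  (forall x, `|x| <= 1 -> `|f x| <= M) -> opnorm f <= M.
Proof.
move=> fM; apply: ge_sup; first by case: (opnorm_has_sup f).
by move=> _ [x /= x1 <-]; exact: fM.
Qed.

Lemma opnorm_bound (f : cdual) x : `|f x| <= opnorm f * `|x|.
Proof.
have [->|x0] := eqVneq x 0; first by rewrite linear0 !normr0 mulr0.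
have nx0 : 0 < `|x| by rewrite normr_gt0.
rewrite -ler_pdivrMr//.
have -> : `|f x| / `|x| = `|f (`|x|^-1 *: x)|.
  by rewrite linearZ/= normrM normfV normr_id mulrC.
by apply: opnorm_ub; rewrite normrZ normfV normr_id mulVf// gt_eqF.
Qed.

Lemma opnorm_ge0 (f : cdual) : 0 <= opnorm f.
Proof. by rewrite (le_trans _ (opnorm_ub _ (x := 0) _)) ?normr0. Qed.

Fact opnormD (f g : cdual) : opnorm (f + g) <= opnorm f + opnorm g.
Proof.
apply: opnorm_le => x x1; rewrite cdualD (le_trans (ler_normD _ _))//.
by rewrite lerD// opnorm_ub.
Qed.

Fact opnormZ (a : R) (f : cdual) : opnorm (a *: f) = `|a| * opnorm f.
Proof.
have le b (h : cdual) : opnorm (b *: h) <= `|b| * opnorm h.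
  apply: opnorm_le => x x1; rewrite cdualZ normrM ler_wpM2l//.
  exact: opnorm_ub.
have [->|a0] := eqVneq a 0.
  apply/eqP; rewrite eq_le le/= normr0 mul0r.
  exact: opnorm_ge0.
apply/eqP; rewrite eq_le le/= -[in leLHS](scale1r f) -(mulVf a0) -scalerA.
rewrite (le_trans (ler_wpM2l _ (le _ _)))// mulrA -normrM divff//.
by rewrite normr1 mul1r.
Qed.

Fact opnorm_eq0 (f : cdual) : opnorm f = 0 -> f = 0.
Proof.
move=> f0; apply: cdualP => x; apply/eqP; rewrite -normr_le0.
by rewrite (le_trans (opnorm_bound f x))// f0 mul0r.
Qed.

HB.instance Definition _ :=
  Lmodule_isNormed.Build R cdual opnormD opnormZ opnorm_eq0.

Lemma cdual_normE (f : cdual) : `|f| = opnorm f.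
Proof. by []. Qed.

End cdual.
Arguments cdual {R} X.

Section reflexive.
Context {R : realType} {X : normedModType R}.

Fact cdual_eval_subproof (x : X) :
  (fun u : cdual X => u x : R^o) \in @cdual_pred R (cdual X).
Proof.
have lin : linear (fun u : cdual X => u x : R^o) by [].
pose ev := GRing.isLinear.Build R (cdual X) R^o *:%R _ lin.
pose evl : {linear cdual X -> R^o} := HB.pack (fun u : cdual X => u x : R^o) ev.
rewrite inE; split => //; apply: (@bounded_linear_continuous _ _ _ evl).
apply/linear_boundedP; near=> r => u.
by rewrite (le_trans (opnorm_bound u x))// mulrC ler_wpM2r ?opnorm_ge0//.
Unshelve. all: by end_near. Qed.

Definition cdual_eval (x : X) : cdual (cdual X) :=
  CDual (cdual_eval_subproof x).

End reflexive.

Definition reflexive_space {R : realType} (X : normedModType R) :=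
  forall F : cdual (cdual X), exists x : X, F = cdual_eval x.

(* Functions to R U {+oo} are \bar R-valued functions that never take the
   value -oo. *)
Section convex_analysis.
Context {R : realType} {V : normedModType R}.
Implicit Types psi : V -> \bar R.
Local Open Scope ereal_scope.

Definition never_ninfty psi := forall x, psi x != -oo.

Definition edom psi : set V := [set x | psi x \is a fin_num].

(* In the library 0 * +oo = 0, while convex analysis often takes 0 * +oo = +oo.
   The two conventions differ only for t = 0 and t = 1, where the inequality
   below holds under both of them. *)
Definition econvex psi := forall (x y : V) (t : R), (0 <= t <= 1)%R ->
  psi (t *: x + (1 - t) *: y)%R <= t%:E * psi x + (1 - t)%:E * psi y.

Definition Gamma0 : set (V -> \bar R) :=
  [set psi | [/\ never_ninfty psi, econvex psi, lower_semicontinuous psi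
               & edom psi !=set0]].

Definition subdiff psi (x : V) : set (cdual V) :=
  [set u | edom psi x /\
           forall z, (u (z - x)%R)%:E <= psi z - psi x].

Definition fenchel_conj psi (y : cdual V) : \bar R :=
  ereal_sup [set (y x)%:E - psi x | x in [set: V]].

End convex_analysis.

Section bipotential.
Context {R : realType} {X : normedModType R}.
Local Open Scope ereal_scope.

(* The subdifferential of a function on the dual, as a subset of X itself
   through the canonical embedding in the bidual *)
Definition subdiff_dual (psi : cdual X -> \bar R) (y : cdual X) : set X :=
  [set x | subdiff psi y (cdual_eval x)].

Record bipotential (b : X -> cdual X -> \bar R) : Prop := Bipotential {
  bipotential_never_ninfty : forall x (y : cdual X), b x y != -oo ;
  bipotential_Gamma0r : forall x, edom (b x) !=set0 -> Gamma0 (b x) ;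
  bipotential_Gamma0l : forall y, edom (b^~ y) !=set0 -> Gamma0 (b^~ y) ;
  bipotential_ge : forall x (y : cdual X), (y x)%:E <= b x y ;
  bipotential_subdiff : forall x (y : cdual X),
    (subdiff (b^~ y) x y <-> subdiff_dual (b x) y x) /\
    (subdiff_dual (b x) y x <-> b x y = (y x)%:E) }.

Definition bipotential_graph (b : X -> cdual X -> \bar R) :
    set (X * cdual X) :=
  [set p | b p.1 p.2 = (p.2 p.1)%:E].

Definition blurred_graph (phi : X -> \bar R) (eps : R) : set (X * cdual X) :=
  [set p | exists a : cdual X,
    (`|a| <= eps)%R /\ subdiff phi p.1 (p.2 + a)%R].

End bipotential.

(* Main.v *)
Require Import Defs.
From HB Require Import structures.
From mathcomp Require Import all_boot all_order all_algebra.
From mathcomp Require Import all_classical all_reals all_analysis.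
From mathcomp Require Import ring lra.

Set Implicit Arguments.
Unset Strict Implicit.
Unset Printing Implicit Defensive.

Import Order.TTheory GRing.Theory Num.Theory.
Import numFieldNormedType.Exports.

Local Open Scope classical_set_scope.
Local Open Scope ring_scope.

(** Let M be the blurred graph, i.e. the set of pairs (x, y) such that some
    point at distance at most eps from y is a subgradient of phi at x.  Any set
    M whose sections M(x) and M^-1(y) are all closed and convex is the graph of
    a bipotential: the function b equal to the duality pairing on M and to +oo
    off M.  Indeed b dominates the pairing, its partial functions are
    restrictions of continuous linear forms to closed convex sets, and at a
    point of M the inequality b(z, y) >= <z, y> is precisely the subgradient
    inequality for b(., y) at x; off M there is no subgradient, the value being
    infinite ([graph_bipotential_bipotential]).  It remains to examine the
    sections.

    The section M(x) is the sum of the convex set of subgradients at x and of a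
    ball, hence convex.  The section M^-1(y) is the union of the
    subdifferentials of the conjugate of phi over the ball of radius eps around
    y, which is convex by assumption; this identification needs that x is a
    subgradient of the conjugate at y if and only if y is a subgradient of phi
    at x
    ([subdiff_fenchel_conjP]).  Its nontrivial half rests on the Hahn-Banach
    theorem, established here by taking a minimal sublinear functional under a
    given one ([hahn_banach_cone]).

    Closedness of both sections follows from closedness of M in X * X^*
    ([blurred_graph_closed]).  If (x', y') in M tends to (x, y), with
    perturbations a' of norm at most eps, then the a' converge weakly-star along
    an ultrafilter ([weak_star_compact]), and the subgradient inequality passes
    to the limit: the pairing is continuous for bounded weak-star convergence
    against norm convergence ([weak_strong_cvg]), and phi is lower
    semicontinuous. *)

(** * Sublinear functionals and the Hahn-Banach theorem *)

Section sublinear.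
Context {R : realType} {V : lmodType R}.
Implicit Types (q f g : V -> R) (C : set (V * R^o)).

(** For homogeneity the inequality suffices: applied to t and to t^-1 it gives
    equality when t > 0. *)
Definition sublinear q :=
  (forall u v, q (u + v) <= q u + q v) /\
  (forall t u, 0 <= t -> q (t *: u) <= t * q u).

Lemma sublinear0 q : sublinear q -> q 0 = 0.
Proof.
move=> [qD qZ]; apply/eqP; rewrite eq_le; apply/andP; split.
  by have := qZ 0 0 (lexx _); rewrite scale0r mul0r.
by have := qD 0 0; rewrite addr0; lra.
Qed.

Lemma sublinear_geN q u : sublinear q -> - q (- u) <= q u.
Proof.
move=> sq; have [qD _] := sq.
by have := qD u (- u); rewrite subrr (sublinear0 sq); lra.
Qed.

Definition convex_cone C :=
  [/\ C 0, forall c d, C c -> C d -> C (c + d) &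
      forall t c, 0 <= t -> C c -> C (t *: c)].

(** Under the compatibility condition assumed below, this is the largest
    sublinear functional g below q with g c.1 <= c.2 on the cone C:
    the infimal convolution of q with the function whose epigraph is generated
    by C.  It serves twice: a minimal sublinear functional is fixed by it, which
    for suitable rays C shows its linearity; and every linear minorant of the
    regularization of q along a cone of constraints satisfies them. *)
Definition cone_regularization q C (u : V) : R :=
  inf [set q (u - c.1) + c.2 | c in C].

Section cone_regularization.
Variables (q : V -> R) (C : set (V * R^o)).
Hypotheses (sq : sublinear q) (coneC : convex_cone C).
Hypothesis qC : forall c, C c -> 0 <= q (- c.1) + c.2.

Let reg_has_lbound u : has_lbound [set q (u - c.1) + c.2 | c in C].
Proof.
exists (- q (- u)) => _ [c Cc <-]; have [qD _] := sq.
by have := qD (u - c.1) (- u); rewrite addrAC subrr add0r; have := qC Cc; lra.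
Qed.

Lemma cone_regularization_le u c :
  C c -> cone_regularization q C u <= q (u - c.1) + c.2.
Proof. by move=> Cc; apply: ge_inf; [exact: reg_has_lbound|exists c]. Qed.

Lemma cone_regularization_ge u m :
  (forall c, C c -> m <= q (u - c.1) + c.2) -> m <= cone_regularization q C u.
Proof.
move=> mC; apply: lb_le_inf; last by move=> _ [c /mC ? <-].
by have [C0 _ _] := coneC; exists (q (u - 0) + 0), 0.
Qed.

Lemma cone_regularization_le_id u : cone_regularization q C u <= q u.
Proof.
have [C0 _ _] := coneC.
by have := cone_regularization_le u C0; rewrite subr0 addr0.
Qed.

Lemma cone_regularization_le_cone c : C c -> cone_regularization q C c.1 <= c.2.
Proof.
move=> Cc; have := cone_regularization_le c.1 Cc.
by rewrite subrr (sublinear0 sq) add0r.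
Qed.

Lemma sublinear_cone_regularization : sublinear (cone_regularization q C).
Proof.
have [C0 CD CZ] := coneC; have [qD qZ] := sq; split=> [u v|t u].
  rewrite -lerBlDr; apply: cone_regularization_ge => c Cc.
  rewrite lerBlDl -lerBlDr; apply: cone_regularization_ge => d Cd.
  rewrite lerBlDr (le_trans (cone_regularization_le _ (CD _ _ Cc Cd)))//=.
  rewrite addrACA opprD [in leLHS]addrACA.
  by have := qD (u - c.1) (v - d.1); lra.
rewrite le_eqVlt => /predU1P[<-|t0].
  rewrite scale0r mul0r (le_trans (cone_regularization_le_id 0))//.
  by rewrite (sublinear0 sq).
rewrite -ler_pdivrMl//; apply: cone_regularization_ge => c Cc.
rewrite ler_pdivrMl//.
rewrite (le_trans (cone_regularization_le _ (CZ _ _ (ltW t0) Cc)))//=.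
by rewrite -scalerBr mulrDr lerD2r qZ// ltW.
Qed.

End cone_regularization.

(** Zorn's lemma applies because the pointwise infimum of a chain of sublinear
    functionals below q is bounded below by - q (- u), and is subadditive since
    two members of a chain are comparable. *)
Lemma exists_minimal_sublinear q : sublinear q ->
  exists2 f, sublinear f /\ (forall u, f u <= q u) &
    forall g, sublinear g -> (forall u, g u <= f u) -> g =1 f.
Proof.
move=> sq; pose T := {f : V -> R | sublinear f /\ forall u, f u <= q u}.
pose le (f g : T) := `[< forall u, sval g u <= sval f u >].
have [||||[f [sf fq]] fmin] := @Zorn T le.
- by move=> f; apply/asboolP.
- move=> f g h /asboolP fg /asboolP gh.
  by apply/asboolP => u; exact: le_trans (gh u) (fg u).
- move=> [f Pf] [g Pg] /asboolP /= gf /asboolP /= fg; apply: eq_exist => /=.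
  by apply/funext => u; apply/eqP; rewrite eq_le fg gf.
- move=> A Atot.
  have [[f0 Af0]|A0] := pselect (A !=set0); last first.
    by exists (exist _ q (conj sq (fun=> lexx _))) => s As; case: A0; exists s.
  pose h u := inf [set sval f u | f in A].
  have hle (f : T) u : A f -> h u <= sval f u.
    move=> Af; apply: ge_inf; last by exists f.
    exists (- q (- u)) => _ [[g [sg gq]] Ag <-] /=.
    by rewrite (le_trans _ (sublinear_geN u sg))// lerN2.
  have hge m u : (forall f : T, A f -> m <= sval f u) -> m <= h u.
    move=> mA; apply: lb_le_inf; first by exists (sval f0 u), f0.
    by move=> _ [f /mA ? <-].
  suff Ph : sublinear h /\ forall u, h u <= q u.
    by exists (exist _ h Ph) => f Af; apply/asboolP => u /=; exact: hle.
  split; last by move=> u; rewrite (le_trans (hle f0 u Af0)) ?(svalP f0).2.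
  split=> [u v|t u].
    rewrite -lerBlDr; apply: (hge _ _) => f Af.
    rewrite lerBlDl -lerBlDr; apply: (hge _ _) => g Ag.
    rewrite lerBlDr.
    have [/asboolP fg|/asboolP gf] := Atot _ _ Af Ag.
      rewrite (le_trans (hle g _ Ag))//.
      by have := (svalP g).1.1 u v; have := fg u; lra.
    rewrite (le_trans (hle f _ Af))//.
    by have := (svalP f).1.1 u v; have := gf v; lra.
  rewrite le_eqVlt => /predU1P[<-|t0].
    rewrite scale0r mul0r (le_trans (hle f0 _ Af0))//.
    by rewrite (sublinear0 (svalP f0).1).
  rewrite -ler_pdivrMl//; apply: (hge _ _) => f Af.
  rewrite ler_pdivrMl// (le_trans (hle f _ Af))//.
  by rewrite (svalP f).1.2// ltW.
exists f => // g sg gf.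
have Pg : sublinear g /\ forall u, g u <= q u.
  by split=> // u; exact: le_trans (gf u) (fq u).
have /= := fmin (exist _ g Pg); rewrite /le /= => /(_ _)/(congr1 sval)/= -> //.
exact/asboolP.
Qed.

(** Regularizing f along the ray generated by (- v, - f v) cannot change it, by
    minimality; this says f u <= f (u + v) - f v, so f is additive. *)
Lemma minimal_sublinear_linear f : sublinear f ->
    (forall g, sublinear g -> (forall u, g u <= f u) -> g =1 f) ->
  linear (f : V -> R^o).
Proof.
move=> sf fmin; have [fD fZ] := sf.
have f0 := sublinear0 sf.
have fDr u v : f (u + v) = f u + f v.
  pose C : set (V * R^o) :=
    [set (- (t *: v), - (t * f v)) | t in [set t | 0 <= t]].
  have coneC : convex_cone C.
    split.
    - by exists 0; rewrite //= scale0r mul0r !oppr0.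
    - move=> _ _ [s /= s0 <-] [t /= t0 <-].
      exists (s + t); first exact: addr_ge0.
      by rewrite scalerDl mulrDl !opprD.
    - move=> a _ a0 [t /= t0 <-]; exists (a * t); first exact: mulr_ge0.
      by rewrite -scalerA -mulrA -scalerN -mulrN.
  have fC c : C c -> 0 <= f (- c.1) + c.2.
    move=> [t /= t0 <-]/=; rewrite opprK subr_ge0.
    move: t0; rewrite le_eqVlt => /predU1P[<-|t0].
      by rewrite mul0r scale0r f0.
    rewrite mulrC -ler_pdivlMr// mulrC.
    have := fZ t^-1 (t *: v); rewrite scalerA mulVf ?gt_eqF// scale1r.
    by rewrite invr_ge0 ltW//; exact.
  have fE := fmin _ (sublinear_cone_regularization sf coneC fC)
    (cone_regularization_le_id sf coneC fC).
  apply/eqP; rewrite eq_le fD/= -lerBrDr -(fE u).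
  have := @cone_regularization_le _ _ sf fC u (- v, - f v).
  rewrite /= opprK; apply; exists 1 => //=.
  by rewrite scale1r mul1r.
have fN u : f (- u) = - f u.
  by apply/eqP; rewrite -addr_eq0 addrC -fDr subrr f0.
have fZr t u : 0 <= t -> f (t *: u) = t * f u.
  move=> t0; apply/eqP; rewrite eq_le fZ//=.
  by have := fZ t (- u) t0; rewrite scalerN !fN mulrN lerN2.
move=> t u v; rewrite fDr; congr (_ + _).
have [/fZr ->//|/ltW t0] := leP 0 t.
rewrite -[t *: u]opprK -scaleNr fN fZr ?oppr_ge0//.
by rewrite mulNr opprK.
Qed.

(** A form of the Hahn-Banach theorem in which the prescribed values on a
    subspace are replaced by upper bounds on a convex cone. *)
Lemma hahn_banach_cone q C : sublinear q -> convex_cone C ->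
    (forall c, C c -> 0 <= q (- c.1) + c.2) ->
  exists2 f : V -> R, linear (f : V -> R^o) &
    (forall u, f u <= q u) /\ (forall c, C c -> f c.1 <= c.2).
Proof.
move=> sq coneC qC.
have [f [sf fle] fmin] :=
  exists_minimal_sublinear (sublinear_cone_regularization sq coneC qC).
exists f; first exact: minimal_sublinear_linear.
split=> [u|c Cc]; apply: (le_trans (fle _)).
  exact: cone_regularization_le_id.
exact: cone_regularization_le_cone.
Qed.

End sublinear.

(** * Continuous affine minorants and the conjugate *)

Section normed.
Context {R : realType} {X : normedModType R}.

Lemma cdual_evalB (u v : cdual X) (x : X) :
  cdual_eval x (u - v) = u x - v x :> R.
Proof. by []. Qed.

Lemma cdual_of_bounded (f : X -> R) (k : R) : linear (f : X -> R^o) ->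
  (forall u, `|f u| <= k * `|u|) -> exists g : cdual X, g =1 f.
Proof.
move=> linf fk.
pose lf := GRing.isLinear.Build R X R^o *:%R (f : X -> R^o) linf.
pose fl : {linear X -> R^o} := HB.pack (f : X -> R^o) lf.
have fP : (f : X -> R^o) \in @cdual_pred R X.
  rewrite inE; split => //; apply: (@bounded_linear_continuous _ _ _ fl).
  apply/linear_boundedP; apply: filterS (nbhs_pinfty_ge (num_real k)) => r kr u.
  by rewrite (le_trans (fk u))// ler_wpM2r.
by exists (CDual fP).
Qed.

(** A separation of the convex set E from the open cone of the points (z, r)
    with r < m - k * `|z - x|, by a non-vertical hyperplane through its apex
    (x, m).  The hypothesis says exactly that the sublinear functional
    k * `|u| is compatible with the constraints given by the cone generated by
    E - (x, m); the linear form given by Hahn-Banach is then k-Lipschitz, hence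
    continuous. *)
Lemma exists_affine_minorant (E : set (X * R^o)) (x : X) (k m : R) :
    0 <= k -> E !=set0 ->
    (forall p q (t : R), 0 <= t <= 1 -> E p -> E q ->
      E (t *: p + (1 - t) *: q)) ->
    (forall p, E p -> m <= p.2 + k * `|p.1 - x|) ->
  exists f : cdual X, forall p, E p -> f (p.1 - x) + m <= p.2.
Proof.
move=> k0 [p0 Ep0] cvxE mE.
pose q (u : X) := k * `|u|.
have sq : sublinear q.
  split=> [u v|t u t0]; rewrite /q.
    by rewrite -mulrDr ler_wpM2l// ler_normD.
  by rewrite normrZ ger0_norm// mulrCA.
pose C : set (X * R^o) := [set c | exists (t : R) p,
  [/\ 0 <= t, E p & c = (t *: (p.1 - x), t * (p.2 - m))]].
have coneC : convex_cone C.
  split.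
  - by exists 0, p0; split; rewrite // scale0r mul0r.
  - move=> _ _ [s [p [s0 Ep ->]]] [t [p' [t0 Ep' ->]]].
    have [st0|st0] := eqVneq (s + t) 0.
      have [-> ->] : s = 0 /\ t = 0 by split; lra.
      by exists 0, p0; split; rewrite // !scale0r !mul0r addr0.
    have st_gt0 : 0 < s + t by rewrite lt_neqAle eq_sym st0 addr_ge0.
    (* The two rays meet the sum at the convex combination of p and p' with
       weights proportional to s and t. *)
    have [a [a01 sa ta]] : exists a : R,
        [/\ 0 <= a <= 1, (s + t) * a = s & (s + t) * (1 - a) = t].
      exists (s / (s + t)); split; try by field.
      by rewrite divr_ge0 ?(ltW st_gt0)//= ler_pdivrMr// mul1r lerDl.
    exists (s + t), (a *: p + (1 - a) *: p').
    split; [exact: ltW|exact: cvxE|].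
    congr (_, _) => /=.
      rewrite [in RHS]scalerBr [in RHS]scalerDr !scalerA.
      by rewrite sa ta !scalerBr addrACA -opprD -scalerDl.
    change (s * (p.2 - m) + t * (p'.2 - m) =
      (s + t) * (a * p.2 + (1 - a) * p'.2 - m) :> R).
    by rewrite !mulrBr mulrDr !mulrA sa ta mulrDl opprD addrACA.
  - move=> a _ a0 [t [p [t0 Ep ->]]]; exists (a * t), p; split => //.
      exact: mulr_ge0.
    by rewrite -scalerA -mulrA.
have qC c : C c -> 0 <= q (- c.1) + c.2.
  move=> [t [p [t0 Ep ->]]] /=.
  rewrite /q normrN normrZ (ger0_norm t0) mulrCA -mulrDr mulr_ge0//.
  by have := mE _ Ep; lra.
have [f linf [fq fC]] := hahn_banach_cone sq coneC qC.
have f0 : f 0 = 0.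
  by have := linf (-1) 0 0; rewrite scaler0 addr0 scaleN1r addNr.
have fN u : f (- u) = - f u.
  by have := linf (-1) u 0; rewrite !scaleN1r addr0 f0 addr0.
have [u|g gE] := cdual_of_bounded (k := k) linf.
  by rewrite ler_norml fq andbT lerNl -fN -(normrN u) fq.
exists g => p Ep; rewrite gE -lerBrDr.
have := fC (1 *: (p.1 - x), 1 * (p.2 - m)); rewrite scale1r mul1r; apply.
by exists 1, p; split; rewrite ?scale1r ?mul1r.
Qed.

(** Adding the values instead of subtracting them makes the finiteness of
    phi x automatic, so that the inequality can be passed to the limit. *)
Lemma subdiffP (phi : X -> \bar R) (x : X) (u : cdual X) :
    never_ninfty phi -> edom phi !=set0 ->
  subdiff phi x u <-> (forall z, phi x + (u (z - x))%:E <= phi z)%E.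
Proof.
move=> phiN [z0 phiz0]; split=> [[xdom ux] z|ux].
  have := ux z.
  rewrite -[in X in _ -> X](fineK xdom) -[in X in X -> _](fineK xdom).
  case: (phi z) (phiN z) => [s _|_ _|//]; last by rewrite leey.
  by rewrite -EFinB -EFinD !lee_fin; lra.
have xdom : edom phi x.
  have := ux z0; move: (phiN x) phiz0; rewrite /edom /=.
  by case: (phi x) => [r||]//; case: (phi z0).
split=> // z; have := ux z; rewrite -(fineK xdom).
case: (phi z) (phiN z) => [s _|_ _|//]; last by rewrite addye// !leey.
by rewrite -EFinB -EFinD !lee_fin; lra.
Qed.

Lemma fenchel_young (phi : X -> \bar R) (z : X) (y : cdual X) :
  ((y z)%:E - phi z <= fenchel_conj phi y)%E.
Proof. by apply: ereal_sup_ubound; exists z. Qed.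

(** From right to left this is the Fenchel-Young inequality and its equality
    case.  From left to right, let x be a subgradient of the conjugate at y,
    whose value there is c, and suppose phi x > y x - c.  By lower
    semicontinuity the nonnegative function phi - y + c is at least some d > 0
    near x, so its epigraph lies above a cone with apex (x, d).  The linear form
    f separating them gives a value of the conjugate at y + f of at most
    c + f x - d, against the lower bound c + f x due to the subgradient x. *)
Lemma subdiff_fenchel_conjP (phi : X -> \bar R) (x : X) (y : cdual X) :
  Gamma0 phi -> subdiff_dual (fenchel_conj phi) y x <-> subdiff phi x y.
Proof.
move=> [phiN phiC phiL [z0 z0dom]]; split; last first.
  move=> [xdom yx].
  have conjE : fenchel_conj phi y = ((y x)%:E - phi x)%E.
    apply/eqP; rewrite eq_le fenchel_young andbT; apply: ge_ereal_sup.
    move=> _ [z _ <-]; have := yx z; rewrite -(fineK xdom) linearB/=.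
    case: (phi z) (phiN z) => [s _|_ _|//]; last by rewrite /= leNye.
    by rewrite -!EFinB !lee_fin; lra.
  split=> [|v]; first by rewrite /edom /= conjE fin_numB xdom.
  rewrite cdual_evalB conjE.
  have := fenchel_young phi x v; rewrite -(fineK xdom).
  case: (fenchel_conj phi v) => [s||]; last by rewrite leeNy_eq.
    by rewrite -!EFinB !lee_fin; lra.
  by rewrite -!EFinB addye// !leey.
move=> [ydom xy].
pose c := fine (fenchel_conj phi y).
have cE : fenchel_conj phi y = c%:E by rewrite fineK.
have phi_ge z : ((y z - c)%:E <= phi z)%E.
  have := fenchel_young phi z y; rewrite cE.
  case: (phi z) (phiN z) => [s _|_ _|//]; last by rewrite leey.
  by rewrite -EFinB !lee_fin; lra.
suff phix : (phi x <= (y x - c)%:E)%E.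
  apply/(subdiffP x y phiN); first by exists z0.
  move=> z; apply: le_trans (phi_ge z).
  move: phix; case: (phi x) (phiN x) => [s _|//|//].
  by rewrite -EFinD !lee_fin linearB/=; lra.
rewrite leNgt; apply/negP => phix.
have [d d_gt0 /phiL[U Ux phiU]] :
    exists2 d : R, 0 < d & ((y x - c + 2 * d)%:E < phi x)%E.
  move: phix; case: (phi x) (phiN x) => [s _|_ _|//].
    rewrite lte_fin => ys.
    by exists ((s - (y x - c)) / 3); rewrite ?lte_fin; lra.
  by exists 1; rewrite ?ltey.
have : nbhs x (U `&` [set z | y z <= y x + d]).
  apply: filterI => //.
  have := @cdual_continuous _ _ y x; move/cvgr_le; apply; lra.
move=> /nbhs_ballP[e /= e0 eU].
pose E : set (X * R^o) := [set p | (phi p.1 <= (y p.1 - c + p.2)%:E)%E].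
(* The slope d / e makes the cone drop from d at x to 0 at distance e, beyond
   which phi - y + c >= 0 is enough. *)
have [||||f fE] := @exists_affine_minorant E x (d / e) d.
- by rewrite divr_ge0 ?ltW.
- exists (z0, fine (phi z0) - (y z0 - c)).
  rewrite /E /= -[in leLHS](fineK z0dom) lee_fin; lra.
- move=> p q t t01 Ep Eq; rewrite /E /=.
  apply: (le_trans (phiC _ _ _ t01)); case/andP: t01 => t0 t1.
  have tp : (t%:E * phi p.1 <= t%:E * (y p.1 - c + p.2)%:E)%E.
    by rewrite lee_wpmul2l// lee_fin.
  have tq : ((1 - t)%:E * phi q.1 <= (1 - t)%:E * (y q.1 - c + q.2)%:E)%E.
    by rewrite lee_wpmul2l// lee_fin; lra.
  apply: (le_trans (leeD tp tq)); rewrite -!EFinM -EFinD lee_fin.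
  have -> : y (t *: p.1 + (1 - t) *: q.1) = t * y p.1 + (1 - t) * y q.1 :> R.
    by rewrite linearD !linearZ.
  change (t * (y p.1 - c + p.2) + (1 - t) * (y q.1 - c + q.2) <=
    t * y p.1 + (1 - t) * y q.1 - c + (t * p.2 + (1 - t) * q.2) :> R).
  by lra.
- move=> [z r] /= Ezr.
  have [zball|zball] := ltP `|z - x| e.
    have [Uz /= yz] : (U `&` [set z | y z <= y x + d]) z.
      by apply: eU; rewrite -ball_normE /= distrC.
    have := lt_le_trans (phiU _ Uz) Ezr; rewrite lte_fin /=.
    have : 0 <= d / e * `|z - x| by rewrite mulr_ge0// divr_ge0 ?ltW.
    by lra.
  have r0 : 0 <= r by have := le_trans (phi_ge z) Ezr; rewrite lee_fin /=; lra.
  have : d <= d / e * `|z - x|.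
    by rewrite mulrAC ler_pdivlMr// ler_pM2l.
  by lra.
have conj_le : (fenchel_conj phi (y + f)%R <= (c + f x - d)%:E)%E.
  apply: ge_ereal_sup => _ [z _ <-]; rewrite cdualD.
  have := fE (z, fine (phi z) - (y z - c)); rewrite /E /=.
  case: (phi z) (phiN z) => [s _|_ _|//]; last by rewrite leNye.
  rewrite /= !lee_fin linearB/= => fz.
  by have := fz ltac:(lra); lra.
have := le_trans (xy (y + f)) (leeB conj_le (lexx (fenchel_conj phi y))).
rewrite cE -EFinB lee_fin /= addrAC subrr add0r; lra.
Qed.

End normed.

(** * Weak-star compactness and the blurred graph *)

Section weak_star.
Context {R : realType} {X : normedModType R}.

Lemma ultra_bounded_cvg (T : Type) (F : set_system T) (f : T -> R) (a b : R) :
  UltraFilter F -> (\forall t \near F, a <= f t <= b) ->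
  exists l : R, f @ F --> l.
Proof.
move=> FU fab.
have [|l [_ lcl]] := @segment_compact R a b (f @ F) _.
  by apply: filterS fab => t; rewrite /= in_itv.
exists l => U Ul; have [//|FnU] := in_ultra_setVsetC (f @^-1` U) FU.
by have [r [nUr Ur]] := lcl (~` U) U FnU Ul.
Qed.

(** The Banach-Alaoglu theorem, in the form needed here: bounded functionals
    converge pointwise along an ultrafilter, and the pointwise limit inherits
    linearity and the norm bound. *)
Lemma weak_star_compact (T : Type) (F : set_system T) (u : T -> cdual X)
    (r : R) : UltraFilter F -> (\forall t \near F, `|u t| <= r) ->
  exists2 v : cdual X, `|v| <= r & forall w, u t w @[t --> F] --> (v w : R).
Proof.
move=> FU ur.
have uw w : \forall t \near F, `|u t w| <= r * `|w|.
  apply: filterS ur => t ur; apply: (le_trans (opnorm_bound _ _)).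
  by rewrite ler_wpM2r.
have /choice[v vE] (w : X) : exists l : R, u t w @[t --> F] --> l.
  apply: (@ultra_bounded_cvg _ _ _ (- (r * `|w|)) (r * `|w|)).
  by apply: filterS (uw w) => t; rewrite ler_norml.
have linv : linear (v : X -> R^o).
  move=> a w w'; apply: (cvg_unique (@Rhausdorff R) (vE _)).
  have -> : (fun t => u t (a *: w + w')) = (fun t => a * u t w + u t w' : R).
    by apply/funext => t; rewrite linearP.
  by apply: cvgD; [apply: cvgMl_tmp; exact: vE|exact: vE].
have vr w : `|v w| <= r * `|w|.
  by apply: cvgr_to_le (cvg_norm (vE w)) (uw w).
have [g gE] := cdual_of_bounded linv vr.
have r0 : 0 <= r.
  by have [t /(le_trans (normr_ge0 _))] := filter_ex ur.
exists g; last by move=> w; rewrite gE; exact: vE.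
rewrite cdual_normE; apply: opnorm_le => w w1; rewrite gE.
by rewrite (le_trans (vr w))// ler_piMr.
Qed.

(** Boundedness is what makes the pairing jointly continuous:
    u t (x t) = u t w + u t (x t - w), and the last term is at most
    r * `|x t - w|. *)
Lemma weak_strong_cvg (T : Type) (F : set_system T) (u : T -> cdual X)
    (x : T -> X) (v : cdual X) (w : X) (r : R) : Filter F ->
    (\forall t \near F, `|u t| <= r) ->
    (forall z, u t z @[t --> F] --> (v z : R)) -> x @ F --> w ->
  u t (x t) @[t --> F] --> (v w : R).
Proof.
move=> FF ur uv xw.
have -> : (fun t => u t (x t)) = (fun t => u t w + u t (x t - w) : R).
  by apply/funext => t; rewrite -linearD subrKC.
rewrite -[X in _ --> X]addr0; apply: cvgD; first exact: uv.
apply/norm_cvg0P/(@squeeze_cvgr _ _ _ _ (fun=> 0) (fun t => r * `|x t - w|)).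
- apply: filterS ur => t ur; rewrite normr_ge0/=.
  by rewrite (le_trans (opnorm_bound _ _))// ler_wpM2r.
- exact: cvg_cst.
- rewrite -[X in _ --> X](mulr0 r) -(@normr0 _ X).
  apply: cvgMl_tmp; apply: cvg_norm.
  by rewrite -(subrr w); apply: cvgB => //; exact: cvg_cst.
Qed.

(** Perturbations realizing membership in the graph are chosen along an
    ultrafilter that converges to (x, y) within the graph; their weak-star limit
    is a perturbation realizing membership of (x, y). *)
Lemma blurred_graph_closed (phi : X -> \bar R) (eps : R) : Gamma0 phi ->
  closed (blurred_graph phi eps).
Proof.
move=> [phiN _ phiL phi0] [x y] xyM.
set M := blurred_graph phi eps in xyM.
have FP : ProperFilter (within M (nbhs (x, y))) by exact: within_nbhs_proper.
have [F [FU wF]] := ultraFilterLemma FP.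
have FM : F M by apply: wF; exact: withinT.
have Fxy : F --> (x, y) by apply: cvg_trans wF _; exact: cvg_within.
have /choice[a aM] (p : X * cdual X) : exists a : cdual X,
    M p -> `|a| <= eps /\ subdiff phi p.1 (p.2 + a).
  have [[b bp]|np] := pselect (M p); last by exists 0.
  by exists b.
have [|b beps ab] := @weak_star_compact _ F a eps FU.
  by apply: filterS FM => p /aM[].
have Fx : p.1 @[p --> F] --> x by apply: cvg_comp Fxy _; exact: cvg_fst.
have Fy : p.2 @[p --> F] --> y by apply: cvg_comp Fxy _; exact: cvg_snd.
exists b; split => //; apply/(subdiffP _ _ phiN) => // z /=.
case phizE : (phi z) (phiN z) => [s||//] _; last by rewrite leey.
have limz : (p.2 + a p)%R (z - p.1) @[p --> F] --> ((y + b) (z - x) : R).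
  apply: (@weak_strong_cvg _ _ _ _ _ _ (`|y| + 1 + eps)).
  - have : \forall p \near F, `|p.2| <= `|y| + 1.
      by apply: (cvgr_le (`|y| : R) (cvg_norm Fy)); rewrite ltrDl.
    apply: filterS2 FM => p /aM[aeps _] p2.
    by rewrite (le_trans (ler_normD _ _))// lerD.
  - move=> w; apply: cvgD; last exact: ab.
    exact: (@cvg_comp _ _ _ snd (cdual_eval w) _ _ _ Fy
      (@cdual_continuous _ _ (cdual_eval w) y)).
  - by apply: cvgB => //; exact: cvg_cst.
(* A level d strictly between the limit of s - (p.2 + a p) (z - p.1) and phi x:
   the former quantity is an upper bound of phi p.1 on the graph, hence
   phi p.1 < d eventually, against lower semicontinuity at x. *)
rewrite leNgt; apply/negP => sphi.
have [d sd /phiL[U Ux phiU]] :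
    exists2 d : R, s - (y + b) (z - x) < d & (d%:E < phi x)%E.
  move: sphi; case: (phi x) (phiN x) => [q _|_ _|//].
    rewrite -EFinD lte_fin => sq.
    by exists ((s - (y + b) (z - x) + q) / 2); rewrite ?lte_fin; lra.
  by exists (s - (y + b) (z - x) + 1); rewrite ?ltey// ltrDl.
have FU1 : F [set p | U p.1] by exact: Fx.
have Flt : \forall p \near F, s - d < (p.2 + a p)%R (z - p.1).
  by apply: (cvgr_gt _ limz); lra.
have [p [[/aM[_ pa] Up] ltp]] := filter_ex (filterI (filterI FM FU1) Flt).
have := (subdiffP _ _ phiN phi0).1 pa z.
have := phiU _ Up; rewrite phizE.
case: (phi p.1) => [q||]//.
by rewrite lte_fin -EFinD lee_fin /= in ltp *; lra.
Qed.

End weak_star.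

(** * Bipotentials from graphs with closed convex sections *)

Section pairing_indicator.
Context {R : realType}.

Lemma convex_setE (V : lmodType R) (A : set V) : convex_set A <->
  (forall x y (t : R), 0 <= t <= 1 -> A x -> A y -> A (t *: x + (1 - t) *: y)).
Proof.
split=> [cA x y t /andP[t0 t1] Ax Ay|cA x y t /set_mem Ax /set_mem Ay].
  by have := cA x y (Itv01 t0 t1) (mem_set Ax) (mem_set Ay) => /set_mem.
by apply/mem_set; apply: cA => //; apply/andP; split.
Qed.

Definition linear_on (V : normedModType R) (A : set V) (l : cdual V) (x : V) :
    \bar R := if `[< A x >] then (l x)%:E else +oo%E.

Section linear_on.
Context {V : normedModType R}.
Variables (A : set V) (l : cdual V).

Lemma linear_on_in x : A x -> linear_on A l x = (l x)%:E.
Proof. by move=> Ax; rewrite /linear_on asboolT. Qed.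

Lemma linear_on_out x : ~ A x -> linear_on A l x = +oo%E.
Proof. by move=> Ax; rewrite /linear_on asboolF. Qed.

Lemma linear_on_ge x : ((l x)%:E <= linear_on A l x)%E.
Proof. by rewrite /linear_on; case: ifP => // _; rewrite leey. Qed.

Lemma edom_linear_on x : edom (linear_on A l) x <-> A x.
Proof.
rewrite /edom /=; have [Ax|nAx] := pselect (A x).
  by rewrite linear_on_in.
by rewrite linear_on_out.
Qed.

Lemma linear_on_never_ninfty : never_ninfty (linear_on A l).
Proof. by move=> x; rewrite /linear_on; case: ifP. Qed.

Lemma linear_on_econvex : convex_set A -> econvex (linear_on A l).
Proof.
move=> /convex_setE cA x y t t01; have /andP[t0 t1] := t01.
have [->|tn0] := eqVneq t 0.
  by rewrite scale0r add0r subr0 scale1r mul0e add0e mul1e.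
have [->|tn1] := eqVneq t 1.
  by rewrite subrr scale0r addr0 scale1r mul0e adde0 mul1e.
have tgt0 : 0 < t by rewrite lt_neqAle eq_sym tn0.
have tlt1 : 0 < 1 - t by rewrite subr_gt0 lt_neqAle tn1.
have [Ax|nAx] := pselect (A x); last first.
  rewrite (linear_on_out nAx) gt0_muley ?lte_fin// addye ?leey//.
  by rewrite /linear_on; case: ifP => // _; rewrite gt0_muley// lte_fin.
have [Ay|nAy] := pselect (A y); last first.
  rewrite (linear_on_out nAy) gt0_muley ?lte_fin// addey ?leey//.
  by rewrite (linear_on_in Ax).
rewrite !linear_on_in//; last exact: cA.
by rewrite -!EFinM -EFinD lee_fin linearD !linearZ.
Qed.

Lemma linear_on_lsc : closed A -> lower_semicontinuous (linear_on A l).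
Proof.
move=> clA x a ax; have [Ax|nAx] := pselect (A x).
  exists [set z | a < l z].
    apply: (cvgr_gt _ (@cdual_continuous _ _ l x)).
    by rewrite linear_on_in ?lte_fin in ax.
  by move=> z /= az; rewrite (lt_le_trans _ (linear_on_ge z))// lte_fin.
exists (~` A); last by move=> z nAz; rewrite linear_on_out// ltey.
by apply: open_nbhs_nbhs; split => //; exact: closed_openC.
Qed.

Lemma linear_on_Gamma0 : convex_set A -> closed A ->
  edom (linear_on A l) !=set0 -> Gamma0 (linear_on A l).
Proof.
move=> cA clA dom; split => //.
- exact: linear_on_never_ninfty.
- exact: linear_on_econvex.
- exact: linear_on_lsc.
Qed.

(** The form l is itself a minorant, exact on A. *)
Lemma linear_on_subdiff x : subdiff (linear_on A l) x l <-> A x.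
Proof.
split=> [[/edom_linear_on]//|Ax]; split; first exact/edom_linear_on.
move=> z; rewrite linearB/= EFinB (linear_on_in Ax).
by apply: leeB => //; exact: linear_on_ge.
Qed.

End linear_on.
End pairing_indicator.

Section graph_bipotential.
Context {R : realType} {X : normedModType R}.
Variable M : set (X * cdual X).
Hypothesis cvxr : forall x, convex_set [set y | M (x, y)].
Hypothesis clr : forall x, closed [set y | M (x, y)].
Hypothesis cvxl : forall y, convex_set [set x | M (x, y)].
Hypothesis cll : forall y, closed [set x | M (x, y)].

(** This is also [linear_on] of the other section at [cdual_eval x], by
    conversion, which makes the two variables play symmetric roles. *)
Definition graph_bipotential (x : X) (y : cdual X) : \bar R :=
  linear_on [set x | M (x, y)] y x.

Lemma graph_bipotentialE x y : graph_bipotential x y = (y x)%:E <-> M (x, y).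
Proof.
split; last by move=> Mxy; rewrite /graph_bipotential linear_on_in.
by rewrite /graph_bipotential /linear_on; case: ifPn => // /asboolP.
Qed.

Lemma graph_bipotential_bipotential : bipotential graph_bipotential.
Proof.
split.
- by move=> x y; exact: linear_on_never_ninfty.
- by move=> x; exact: (@linear_on_Gamma0 _ _ [set y | M (x, y)] (cdual_eval x)).
- by move=> y; apply: linear_on_Gamma0.
- by move=> x y; exact: linear_on_ge.
- move=> x y; split.
    apply: (iff_trans (@linear_on_subdiff _ _ _ y x)).
    apply: iff_sym.
    exact: (@linear_on_subdiff _ _ [set y | M (x, y)] (cdual_eval x) y).
  apply: iff_trans (iff_sym (graph_bipotentialE x y)).
  exact: (@linear_on_subdiff _ _ [set y | M (x, y)] (cdual_eval x) y).
Qed.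

End graph_bipotential.

Section blurred_sections.
Context {R : realType} {X : normedModType R}.
Variables (phi : X -> \bar R) (eps : R).
Hypothesis phiG : Gamma0 phi.

Local Notation M := (blurred_graph phi eps).

Lemma blurred_graph_closedr x : closed [set y | M (x, y)].
Proof.
apply: (@preimage_closed _ _ (fun y : cdual X => (x, y)) M).
  move=> y _; exact: (@cvg_pair _ _ _ (nbhs y) (nbhs x) (nbhs y) _ _ _
    (fun=> x) idfun (cvg_cst _) cvg_id).
exact: blurred_graph_closed.
Qed.

Lemma blurred_graph_closedl y : closed [set x | M (x, y)].
Proof.
apply: (@preimage_closed _ _ (fun x : X => (x, y)) M).
  move=> x _; exact: (@cvg_pair _ _ _ (nbhs x) (nbhs x) (nbhs y) _ _ _
    idfun (fun=> y) cvg_id (cvg_cst _)).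
exact: blurred_graph_closed.
Qed.

Lemma blurred_graph_convexr x : convex_set [set y | M (x, y)].
Proof.
have [phiN _ _ phi0] := phiG.
apply/convex_setE => y1 y2 t /andP[t0 t1] [a1 [a1e s1]] [a2 [a2e s2]].
exists (t *: a1 + (1 - t) *: a2); split.
  rewrite (le_trans (ler_normD _ _))// !normrZ.
  rewrite ger0_norm// ger0_norm ?subr_ge0//.
  by nra.
have [xdom _] := s1; split=> // z; rewrite addrACA -!scalerDr.
move: s1.2 s2.2 => /(_ z) + /(_ z); rewrite /= -(fineK xdom).
case: (phi z) (phiN z) => [s _|_ _|//]; last by rewrite addye// !leey.
rewrite -EFinB !lee_fin; move: (_ - fine _) => r s1z s2z.
change (t * (y1 + a1)%R (z - x) + (1 - t) * (y2 + a2)%R (z - x) <=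
  r :> R).
by nra.
Qed.

(** Identifies the sections along X with the sets assumed to be convex. *)
Lemma blurred_graph_sectionl y : [set x | M (x, y)] =
  \bigcup_(y' in [set y' : cdual X | `|y' - y| <= eps])
     subdiff_dual (fenchel_conj phi) y'.
Proof.
apply/seteqP; split=> x.
  move=> [a [ae s]]; exists (y + a) => /=; first by rewrite addrAC subrr add0r.
  exact/subdiff_fenchel_conjP.
move=> [y' /= y'e /(subdiff_fenchel_conjP _ _ phiG) s]; exists (y' - y).
by rewrite subrKC.
Qed.

End blurred_sections.

Theorem corollary1p1 (R : realType) (X : completeNormedModType R)
    (reflX : reflexive_space X)
    (phi : X -> \bar R) (phiG : Gamma0 phi)
    (eps : R) (eps_gt0 : 0 < eps)
    (cvx : forall y : cdual X,
      convex_set (\bigcup_(y' in [set y' : cdual X | `|y' - y| <= eps])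
                    subdiff_dual (fenchel_conj phi) y')) :
  (exists b : X -> cdual X -> \bar R,
     bipotential b /\ blurred_graph phi eps = bipotential_graph b) /\
  (exists b : X -> cdual X -> \bar R,
     [/\ forall x y, b x y != -oo%E,
         forall x, lower_semicontinuous (b x) /\ econvex (b x),
         forall y, lower_semicontinuous (b^~ y) /\ econvex (b^~ y)
       & forall x y,
           [/\ subdiff (b^~ y) x y <-> blurred_graph phi eps (x, y),
               subdiff_dual (b x) y x <-> blurred_graph phi eps (x, y)
             & b x y = (y x)%:E <-> blurred_graph phi eps (x, y)]]).
Proof.
pose M := blurred_graph phi eps.
have cvxr x : convex_set [set y | M (x, y)] by exact: blurred_graph_convexr.
have clr x : closed [set y | M (x, y)] by exact: blurred_graph_closedr.
have cvxl y : convex_set [set x | M (x, y)].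
  by rewrite /M blurred_graph_sectionl.
have cll y : closed [set x | M (x, y)] by exact: blurred_graph_closedl.
have bip := graph_bipotential_bipotential cvxr clr cvxl cll.
split; exists (graph_bipotential M).
  split=> //; apply/seteqP.
  by split=> -[x y] /graph_bipotentialE.
have [bN _ _ _ bS] := bip; split=> //.
- move=> x; split.
    exact: (@linear_on_lsc _ _ [set y | M (x, y)] (cdual_eval x)).
  exact: (@linear_on_econvex _ _ [set y | M (x, y)] (cdual_eval x)).
- by move=> y; split; [exact: linear_on_lsc|exact: linear_on_econvex].
- move=> x y; have [lr rE] := bS x y; have E := graph_bipotentialE M x y.
  split; [exact: iff_trans lr (iff_trans rE E)|exact: iff_trans rE E|exact: E].
Qed.
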